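(* Let $(X,d)$ be a metric space that is an $s$-snowflake for some $s\in[1,\infty)$. If $1\le p\le q<2$, then $(X,d)$ does not support a $(p,q)$-metric cotype inequality whose scaling function satisfies $m_{p,q}(n)=O(n^{1/q})$.
   Context: Snowflakes. For $s\in[1,\infty]$, a metric space $(X,d)$ is an $L^s$-metric space if for all $x,y,z\in X$: $d(x,y)\le (d(x,z)^s+d(z,y)^s)^{1/s}$ when $s<\infty$, and $d(x,y)\le\max\{d(x,z),d(z,y)\}$ when $s=\infty$. Two metric spaces $(X,d_X)$, $(Y,d_Y)$ are bi-Lipschitz equivalent if there are $L\ge 1$ and a bijection $\phi\colon Y\to X$ with $d_Y(x,y)/L\le d_X(\phi(x),\phi(y))\le L\,d_Y(x,y)$ for all $x,y\in Y$. The snowflake index of $(X,d)$ is $s_X=\sup\{s\in[1,\infty]: (X,d)\text{ is bi-Lipschitz equivalent to an }L^s\text{-metric space}\}$. $(X,d)$ is an $s$-snowflake if $(X,d)$ is bi-Lipschitz equivalent to an $L^s$-metric space and $s=s_X$. Metric cotype. $\mathbb{Z}_m^n$ denotes the $n$-fold product of the integers modulo $m$, and $\mathbf{e}_j$ the $j$th standard basis vector. For $f\colon \mathbb{Z}_m^n\to X$ ($m$ an even positive integer), $1\le j\le n$, and $\delta\in\{-1,0,1\}^n$, put $f_j(\epsilon)=f(\epsilon+\frac m2\mathbf{e}_j)$ and $f_\delta(\epsilon)=f(\epsilon+\delta)$. Let $1\le p\le q<\infty$. A metric space $(X,d)$ supports a $(p,q)$-metric cotype inequality if there are a constant $\Gamma\ge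 1$ and a scaling function $m_{p,q}$ from the positive integers to the even positive integers such that for every positive integer $n$, with $m=m_{p,q}(n)$, every mapping $f\colon\mathbb{Z}_m^n\to X$ satisfies $$\mathbb{E}_{\epsilon\in\mathbb{Z}_m^n}\sum_{j=1}^n d(f(\epsilon),f_j(\epsilon))^p\le \Gamma^p m^p n^{1-(p/q)}\,\mathbb{E}_{\epsilon\in\mathbb{Z}_m^n}\mathbb{E}_{\delta\in\{-1,0,1\}^n} d(f(\epsilon),f_\delta(\epsilon))^p,$$ where the expectations are over uniformly distributed $\epsilon\in\mathbb{Z}_m^n$ and $\delta\in\{-1,0,1\}^n$. *)

(* Defs.v *)
From mathcomp Require Export all_boot all_order all_algebra.
From mathcomp Require Export all_classical all_reals all_analysis.
Import Order.TTheory GRing.Theory Num.Theory.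
Import numFieldNormedType.Exports.

Set Implicit Arguments.
Unset Strict Implicit.
Unset Printing Implicit Defensive.

Local Open Scope classical_set_scope.
Local Open Scope ring_scope.

(* An extended exponent [s] is meant to lie in [1, +oo]. *)
Definition Ls_metric (R : realType) (s : \bar R) (X : metricType R) : Prop :=
  match s with
  | r%:E => forall x y z : X,
      mdist x y <= (mdist x z `^ r + mdist z y `^ r) `^ r^-1
  | +oo%E => forall x y z : X, mdist x y <= Num.max (mdist x z) (mdist z y)
  | -oo%E => False
  end.

Definition bilipschitz_equivalent (R : realType) (X Y : metricType R) : Prop :=
  exists (L : R) (phi : Y -> X),
    [/\ 1 <= L, bijective phi &
        forall x y : Y, mdist x y / L <= mdist (phi x) (phi y) <= L * mdist x y].

Definition bilipschitz_to_Ls (R : realType) (X : metricType R) (s : \bar R) :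
    Prop :=
  exists Y : metricType R, bilipschitz_equivalent X Y /\ Ls_metric s Y.

Definition snowflake_index (R : realType) (X : metricType R) : \bar R :=
  ereal_sup [set s : \bar R | (1%:E <= s)%E /\ bilipschitz_to_Ls X s].

Definition snowflake (R : realType) (X : metricType R) (s : \bar R) : Prop :=
  bilipschitz_to_Ls X s /\ s = snowflake_index X.

(* The discrete torus Z_m^n is ['rV['Z_m]_n]; it has the right number of points
   only when [1 < m], which holds for even positive [m]. *)
Definition half_shift (T : Type) (m n : nat) (f : 'rV['Z_m]_n -> T)
    (j : 'I_n) (e : 'rV['Z_m]_n) : T :=
  f (e + delta_mx 0 j *+ m./2).

(* A vector of {-1, 0, 1}^n is encoded as a finite function into ['I_3], the
   value [k] standing for [k - 1].  The encoding keeps the 3^n vectors distinct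
   for the averaging even when [m = 2], where [-1 = 1] in ['Z_m]. *)
Definition sign_vector (m n : nat) (delta : {ffun 'I_n -> 'I_3}) :
    'rV['Z_m]_n :=
  \row_j ((delta j)%:R - 1).

Definition delta_shift (T : Type) (m n : nat) (f : 'rV['Z_m]_n -> T)
    (delta : {ffun 'I_n -> 'I_3}) (e : 'rV['Z_m]_n) : T :=
  f (e + sign_vector m delta).

Definition average (R : realType) (I : finType) (F : I -> R) : R :=
  (\sum_(i : I) F i) / #|I|%:R.

Definition scaling_function (m : nat -> nat) : Prop :=
  forall n : nat, (0 < n)%N -> (0 < m n)%N /\ ~~ odd (m n).

(* The value of [m] at 0 is irrelevant. *)
Definition metric_cotype (R : realType) (X : metricType R) (p q : R)
    (m : nat -> nat) : Prop :=
  scaling_function m /\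
  exists Gamma : R, 1 <= Gamma /\
    forall n : nat, (0 < n)%N -> forall f : 'rV['Z_(m n)]_n -> X,
      average (fun e => \sum_(j < n) mdist (f e) (half_shift f j e) `^ p)
      <= Gamma `^ p * (m n)%:R `^ p * n%:R `^ (1 - p / q) *
         average (fun e => average (fun delta : {ffun 'I_n -> 'I_3} =>
           mdist (f e) (delta_shift f delta e) `^ p)).

(* Main.v *)
From HB Require Import structures.
From mathcomp Require Import lra ring zify.
Require Import Defs.
Import Order.TTheory GRing.Theory Num.Theory.
Import numFieldNormedType.Exports.

Set Implicit Arguments.
Unset Strict Implicit.
Unset Printing Implicit Defensive.

Local Open Scope classical_set_scope.
Local Open Scope ring_scope.

(* Let Y be an L^s-metric space bi-Lipschitz equivalent to X, so that
   rho = d_Y^s is again a metric.  For every N, the space (Y, rho) contains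
   near-geodesic chains x_0, ..., x_N: all steps are at most r and
   rho(x_0, x_N) >= (N - 1/2) r.  Otherwise every chain of N hops of length at
   most B joins points at distance at most (N - 1/2) B, and a chain argument in
   the style of Frink gives t > 1 and K with
   rho(x_0, x_k) <= K (sum rho(x_i, x_(i+1))^t)^(1/t) for all chains; the
   infimum of sum rho^t over chains, raised to the power 1/(st), is then an
   L^(st)-metric bi-Lipschitz equivalent to d_Y, contradicting s = s_X.

   Map e in Z_m^n to x_(F(e)), where F(e) is the sum of the distances of the
   e_j to 0.  A shift by m/2 in one coordinate changes F by about m on average,
   whereas F(e + delta) - F(e) has second moment at most n because its
   coordinate increments are orthogonal.  With a = p/s < 2 the cotype
   inequality then reads n m^a <= C m^p n^(1 - p/q) n^(a/2), and m = O(n^(1/q))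
   turns it into n^(a/q - a/2) <= C', which is absurd for q < 2. *)

(** * Powers and metrics *)

(** With [S = a + b], each fraction [c / S] lies in [0, 1] and is therefore at most its [r]-th
    power; add the two and multiply by [S^r]. *)
Lemma powR_subadditive (R : realType) (a b r : R) :
  0 <= a -> 0 <= b -> 0 < r -> r <= 1 -> (a + b) `^ r <= a `^ r + b `^ r.
Proof.
move=> a0 b0 r0 r1.
have [/eqP|S0] := eqVneq (a + b) 0.
  rewrite paddr_eq0// => /andP[/eqP-> /eqP->].
  by rewrite addr0 powR0 ?gt_eqF// addr0.
have Sp : 0 < a + b by rewrite lt_def S0 addr_ge0.
have frac c : 0 <= c -> c <= a + b -> c / (a + b) * (a + b) `^ r <= c `^ r.
  move=> c0 cS; have [->|cn] := eqVneq c 0; first by rewrite !mul0r powR_ge0.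
  have cp : 0 < c by rewrite lt_def cn.
  have : c / (a + b) <= (c / (a + b)) `^ r.
    by apply: ger1_powR => //; rewrite divr_gt0//= ler_pdivrMr// mul1r.
  move=> /(ler_wpM2r (powR_ge0 (a + b) r)) /le_trans; apply.
  by rewrite -powRM ?divr_ge0 ?addr_ge0// divfK.
have := lerD (frac a a0 _) (frac b b0 _).
by rewrite -mulrDl -mulrDl divff// mul1r; apply; rewrite ?lerDl ?lerDr.
Qed.

Lemma powR_le2 (R : realType) (a b r : R) : 0 <= r -> 0 <= a -> a <= b ->
  a `^ r <= b `^ r.
Proof.
move=> r0 a0 ab; apply: ge0_ler_powR; rewrite ?nnegrE//; exact: le_trans ab.
Qed.

Lemma powRK (R : realType) (a r : R) : 0 < r -> 0 <= a -> (a `^ r) `^ r^-1 = a.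
Proof. by move=> r0 a0; rewrite -powRrM divff ?gt_eqF// powRr1. Qed.

Lemma powRVK (R : realType) (a r : R) : 0 < r -> 0 <= a -> (a `^ r^-1) `^ r = a.
Proof. by move=> r0 a0; rewrite -powRrM mulVf ?gt_eqF// powRr1. Qed.

(** Allows a second distance on the points of an existing metric space; [phi] is the identity on the
    carrier. *)
Lemma metric_of_dist (R : realType) (T : choiceType) (d : T -> T -> R)
    (d0 : forall x, d x x = 0) (dp : forall x y, d x y = 0 -> x = y)
    (ds : forall x y, d x y = d y x)
    (dt : forall y x z, d x z <= d x y + d y z) :
  exists (Y : metricType R) (phi : Y -> T),
    bijective phi /\ forall x y, mdist x y = d (phi x) (phi y).
Proof.
case: T d d0 dp ds dt => T cT d d0 dp ds dt.
pose C : choiceType := HB.pack T cT.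
pose M := isMetric.Build R C d0 dp ds dt.
pose Y : metricType R := HB.pack T cT M.
exists Y, id; split; first by exists id.
by [].
Qed.

(** * Chains *)

(** The number of hops is exactly [k]; when [rho] vanishes on the diagonal and [B >= 0], stationary
    hops pad shorter chains. *)
Fixpoint reach (R : realType) (T : Type) (rho : T -> T -> R) (B : R) (k : nat)
    (x y : T) : Prop :=
  if k is k'.+1 then exists z, rho x z <= B /\ reach rho B k' z y else x = y.

Lemma reach_refl (R : realType) (T : Type) (rho : T -> T -> R) (B : R) k x :
  rho x x <= B -> reach rho B k x x.
Proof. by move=> h; elim: k => //= k IH; exists x. Qed.

Lemma reach_seq (R : realType) (T : Type) (rho : T -> T -> R) (B : R) k x y :
  reach rho B k x y ->
  exists u : nat -> T, [/\ u 0%N = x, u k = y &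
    forall i, (i < k)%N -> rho (u i) (u i.+1) <= B].
Proof.
elim: k x => [x <-|k IH x /= [z [xz /IH[u [u0 uk ustep]]]]].
  by exists (fun=> x).
exists (fun i => if i is i'.+1 then u i' else x); split => //.
by case=> [|i]; rewrite /= ?u0// ltnS => /ustep.
Qed.

Section chains.
Context (R : realType) (T : Type) (rho : T -> T -> R).
Hypothesis rho_ge0 : forall x y, 0 <= rho x y.
Hypothesis rhoxx : forall x, rho x x = 0.
Hypothesis rho_triangle : forall y x z, rho x z <= rho x y + rho y z.

Lemma rho_steps (x : nat -> T) (r : R) a b :
  (a <= b)%N -> (forall i, (a <= i < b)%N -> rho (x i) (x i.+1) <= r) ->
  rho (x a) (x b) <= (b - a)%:R * r.
Proof.
move=> /subnKC <-; rewrite addKn; elim: (b - a)%N => [|k IH] h.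
  by rewrite addn0 rhoxx mul0r.
apply: le_trans (rho_triangle (x (a + k)%N) _ _) _.
rewrite -natr1 mulrDl mul1r lerD//.
  by apply: IH => i /andP[ai ik]; apply: h; rewrite ai addnS ltnS ltnW.
by rewrite addnS; apply: h; rewrite leq_addr addnS ltnS leqnn.
Qed.

(** By the triangle inequality, the pieces outside [i, j] account for at most [(N - (j - i)) r], so
    every subchain inherits the defect [r / 2]. *)
Lemma near_geodesic_lower (x : nat -> T) (r : R) N :
  (forall i, (i < N)%N -> rho (x i) (x i.+1) <= r) ->
  (N%:R - 2^-1) * r <= rho (x 0%N) (x N) ->
  forall i j, (i <= j <= N)%N -> ((j - i)%:R - 2^-1) * r <= rho (x i) (x j).
Proof.
move=> step far i j /andP[ij jN].
have h1 : rho (x 0%N) (x i) <= i%:R * r.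
  rewrite -{2}(subn0 i); apply: rho_steps => // k /andP[_ ki].
  by apply: step; rewrite (leq_trans ki)// (leq_trans ij).
have h2 : rho (x j) (x N) <= (N - j)%:R * r.
  by apply: rho_steps => // k /andP[_ kN]; apply: step.
have h3 := rho_triangle (x i) (x 0%N) (x N).
have h4 := rho_triangle (x j) (x i) (x N).
rewrite natrB// in h2; rewrite natrB//.
have -> : (j%:R - i%:R - 2^-1) * r =
  (N%:R - 2^-1) * r - i%:R * r - (N%:R - j%:R) * r by ring.
lra.
Qed.

Section frink.
Context (t : R) (x : nat -> T).
Hypothesis t_gt0 : 0 < t.
Local Notation cost a b :=
  (\sum_(a <= i < b) rho (x i) (x i.+1) `^ t).

Lemma cost_ge0 a b : 0 <= cost a b.
Proof. by apply: sumr_ge0 => i _; exact: powR_ge0. Qed.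

Lemma cost_sub a b a' b' :
  (a <= a')%N -> (a' <= b')%N -> (b' <= b)%N -> cost a' b' <= cost a b.
Proof.
move=> aa ab bb; rewrite (big_cat_nat aa (leq_trans ab bb))/=.
rewrite (big_cat_nat ab bb)/=.
have := cost_ge0 a a'; have := cost_ge0 b' b; lra.
Qed.

Lemma step_le_cost a b i : (a <= i < b)%N ->
  rho (x i) (x i.+1) <= cost a b `^ t^-1.
Proof.
move=> /andP[ai ib].
have -> : rho (x i) (x i.+1) = (rho (x i) (x i.+1) `^ t) `^ t^-1.
  by rewrite -powRrM divff ?gt_eqF// powRr1.
apply: powR_le2; rewrite ?powR_ge0 ?invr_ge0 ?(ltW t_gt0)//.
have -> : rho (x i) (x i.+1) `^ t = cost i i.+1 by rewrite big_nat1.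
exact: cost_sub.
Qed.

Lemma greedy_cut (th : R) a b : 0 <= th -> (a <= b)%N -> cost a b <= th \/
  exists c, [/\ (a <= c < b)%N, cost a c <= th & th < cost a c.+1].
Proof.
move=> th0 /subnKC <-; elim: (b - a)%N => [|k IH].
  by left; rewrite addn0 big_geq.
rewrite addnS.
have [h|h] := leP (cost a (a + k).+1) th; first by left.
right; case: IH => [le|[c [/andP[ac ck] h1 h2]]].
  by exists (a + k)%N; split => //; rewrite leq_addr ltnS leqnn.
by exists c; split => //; rewrite ac ltnS ltnW.
Qed.

(** Each hop takes a subchain of cost at most [th] and then the step that crosses the threshold.
    Together they cost more than [th], so the bound on the remaining cost drops by [th] per hop. *)
Lemma greedy_reach (th b1 b2 : R) j a b : 0 <= th -> 0 <= b1 -> 0 <= b2 ->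
  (a <= b)%N -> cost a b <= j.+1%:R * th ->
  (forall a' b', (a <= a')%N -> (a' <= b')%N -> (b' <= b)%N ->
     cost a' b' <= th -> rho (x a') (x b') <= b1) ->
  (forall i, (a <= i < b)%N -> rho (x i) (x i.+1) <= b2) ->
  reach rho (b1 + b2) j.+1 (x a) (x b).
Proof.
move=> th0 b10 b20; elim: j a => [|j IH] a ab cst seg step.
  rewrite mul1r in cst; exists (x b); split => //.
  by rewrite -[leLHS]addr0 lerD// seg.
case: (greedy_cut th0 ab) => [le|[c [/andP[ac cb] le gt]]].
  exists (x b); split; first by rewrite -[leLHS]addr0 lerD// seg.
  by apply: reach_refl; rewrite rhoxx addr_ge0.
exists (x c.+1); split.
  apply: le_trans (rho_triangle (x c) _ _) _; apply: lerD.
    by apply: seg => //; exact: ltnW.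
  by apply: step; rewrite ac.
apply: IH => //.
- rewrite (big_cat_nat (n := c.+1)) ?(leqW ac)//= in cst.
  by rewrite -natr1 mulrDl mul1r in cst; lra.
- by move=> a' b' ca; apply: seg; exact: leq_trans (leqW ac) ca.
- by move=> i /andP[ci ib]; apply: step; rewrite (leq_trans (leqW ac) ci).
Qed.

(* Frink's chain argument, cutting a chain of cost [S] into at most [N]
   hops, each made of a subchain of cost at most [S / N] and one step. *)
Lemma chain_bound (N : nat) (K0 K : R) : (1 < N)%N -> 0 <= K0 -> 0 <= K ->
  (forall B y z, reach rho B N y z -> rho y z <= K0 * B) ->
  K0 * (K * N%:R^-1 `^ t^-1 + 1) <= K ->
  forall a b, (a <= b)%N -> rho (x a) (x b) <= K * cost a b `^ t^-1.
Proof.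
move=> N1 K00 K0' contr KK a b.
have [k] := ubnP (b - a); elim: k a b => // k IH a b bak ab.
(* Cost 0 is treated apart because the splitting needs [S / N < S]; all steps are then 0. *)
have [S0|S0] := eqVneq (cost a b) 0.
  rewrite S0 powR0 ?invr_eq0 ?gt_eqF// mulr0 -(mulr0 (b - a)%:R).
  apply: rho_steps => // i /step_le_cost; rewrite S0 powR0 ?invr_eq0 ?gt_eqF//.
have Sp : 0 < cost a b by rewrite lt_def S0 cost_ge0.
have Np : (0 : R) < N%:R by rewrite ltr0n ltnW.
set S := cost a b in S0 Sp *.
have /contr : reach rho (K * (S / N%:R) `^ t^-1 + S `^ t^-1) N (x a) (x b).
  rewrite -{2}(prednK (ltnW N1)).
  apply: (@greedy_reach (S / N%:R)) => //.
  - by rewrite divr_ge0// ltW.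
  - by rewrite mulr_ge0// powR_ge0.
  - exact: powR_ge0.
  - by rewrite prednK ?(ltnW N1)// mulrC divfK ?gt_eqF.
  - move=> a' b' aa' ab' bb' le.
    have {}IH : rho (x a') (x b') <= K * cost a' b' `^ t^-1.
      (* The subchain is proper, since the whole chain costs [S > S / N]. *)
      apply: IH => //; rewrite (@leq_trans (b - a))// ltn_neqAle leq_sub//.
      rewrite andbT; apply/eqP => e.
      have [ea eb] : a' = a /\ b' = b by lia.
      move: le; rewrite ea eb -/S leNgt ltr_pdivrMr// ltr_pMr//.
      by rewrite ltr1n N1.
    apply: (le_trans IH); apply: ler_wpM2l => //.
    by apply: powR_le2; rewrite ?cost_ge0 ?invr_ge0 ?(ltW t_gt0).
  - by move=> i /step_le_cost.
move=> /le_trans; apply.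
rewrite powRM ?invr_ge0 ?(ltW Np) ?(ltW Sp)//.
have -> : K0 * (K * (S `^ t^-1 * N%:R^-1 `^ t^-1) + S `^ t^-1) =
  K0 * (K * N%:R^-1 `^ t^-1 + 1) * S `^ t^-1 by ring.
by apply: ler_wpM2r => //; exact: powR_ge0.
Qed.

End frink.
End chains.

(** At [t = 1] the factor of [K] is [(N - 1/2) / N < 1]. It stays below 1 for [t] slightly larger,
    and a large [K] then absorbs the additive term. *)
Lemma chain_exponent (R : realType) (N : nat) : (1 < N)%N ->
  exists t K : R, [/\ 1 < t, 0 <= K &
    (N%:R - 2^-1) * (K * N%:R^-1 `^ t^-1 + 1) <= K].
Proof.
move=> N1; set K0 : R := N%:R - 2^-1.
have N2 : (2 : R) <= N%:R by rewrite ler_nat.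
have K1 : 1 < K0 by rewrite /K0; lra.
have lK : 0 < ln K0 by exact: ln_gt0.
have KN : ln K0 < ln N%:R by rewrite ltr_ln ?posrE /K0; lra.
(* [u = 1 / t] is the midpoint of 1 and [log_N K0]; any [u] above that logarithm gives
   [K0 N^(-u) < 1]. *)
pose u := (ln K0 / ln N%:R + 1) / 2.
have lN := lt_trans lK KN.
have u0 : 0 < u by rewrite divr_gt0// addr_gt0// divr_gt0.
have u1 : u < 1 by rewrite /u ltr_pdivrMr// mul1r ltrD2r ltr_pdivrMr// mul1r.
pose al := K0 * N%:R^-1 `^ u.
have a1 : al < 1.
  rewrite /al.
  rewrite -powR_inv1 ?ler0n// -powRrM mulN1r powRN ltr_pdivrMr ?powR_gt0 ?mul1r.
    rewrite -{1}(@lnK _ K0) ?posrE; last lra.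
    rewrite /powR gt_eqF ?ltr_expR; last lra.
    have -> : u * ln N%:R = (ln K0 + ln N%:R) / 2.
      by rewrite /u mulrAC mulrDl mul1r divfK ?gt_eqF.
    lra.
  lra.
  by rewrite ltr0n ltnW.
have al0 : 0 < 1 - al by rewrite subr_gt0.
(* This [K] is the fixed point of [K = al K + K0]. *)
exists u^-1, (K0 / (1 - al)); rewrite invrK; split.
- by rewrite -invr1 ltf_pV2// posrE.
- by rewrite divr_ge0//; lra.
- rewrite mulrDr mulr1 mulrCA -/al.
  have : K0 / (1 - al) * (1 - al) = K0 by rewrite divfK ?gt_eqF.
  by move: (K0 / (1 - al)) => v <-; rewrite -mulrDr addrC subrK mulr1.
Qed.

Section chain_infimum.
Context (R : realType) (T : Type) (w : T -> T -> R).
Hypothesis w_ge0 : forall x y, 0 <= w x y.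
Hypothesis w_sym : forall x y, w x y = w y x.

Definition chain_costs (u v : T) : set R :=
  [set c | exists (n : nat) (x : nat -> T), [/\ x 0%N = u, x n = v &
    c = \sum_(0 <= i < n) w (x i) (x i.+1)]].

(** For symmetric nonnegative [w], this is the largest pseudometric below [w]. *)
Definition chain_inf (u v : T) : R := inf (chain_costs u v).

Lemma chain_costs1 u v : chain_costs u v (w u v).
Proof.
exists 1%N, (fun i => if i is 0%N then u else v); split => //.
by rewrite big_nat1.
Qed.

Lemma chain_inf_ge (u v : T) (c : R) :
  (forall n x, x 0%N = u -> x n = v ->
     c <= \sum_(0 <= i < n) w (x i) (x i.+1)) -> c <= chain_inf u v.
Proof.
move=> h; apply: lb_le_inf; first by exists (w u v); exact: chain_costs1.
by move=> _ [n [x [x0 xn ->]]]; exact: h.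
Qed.

Lemma chain_inf_ge0 u v : 0 <= chain_inf u v.
Proof. by apply: chain_inf_ge => n x _ _; exact: sumr_ge0. Qed.

Lemma chain_inf_le u v c : chain_costs u v c -> chain_inf u v <= c.
Proof.
apply: ge_inf; exists 0 => _ [n [x [_ _ ->]]]; exact: sumr_ge0.
Qed.

Lemma chain_costs_sym u v : chain_costs u v `<=` chain_costs v u.
Proof.
move=> _ [n [x [<- <- ->]]]; exists n, (fun i => x (n - i)%N).
split; rewrite ?subn0 ?subnn//.
rewrite big_nat_rev/= add0n; apply: eq_big_nat => i /andP[_ ni].
by rewrite w_sym subnSK.
Qed.

Lemma chain_inf_sym u v : chain_inf u v = chain_inf v u.
Proof.
by congr inf; apply/seteqP; split; exact: chain_costs_sym.
Qed.

Lemma chain_inf_triangle v u z : chain_inf u z <= chain_inf u v + chain_inf v z.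
Proof.
rewrite -lerBlDr; apply: chain_inf_ge => n x x0 xn.
rewrite lerBlDl -lerBlDr; apply: chain_inf_ge => m y y0 ym.
rewrite lerBlDr; apply: chain_inf_le.
(* The two chains are concatenated; [x n = v = y 0] at the seam. *)
exists (n + m)%N, (fun i => if (i <= n)%N then x i else y (i - n)%N).
split => //.
  case: leqP => h; last by rewrite addKn.
  by have m0 : m = 0%N by [lia]; rewrite -ym m0 y0 addn0.
rewrite addrC [RHS](big_cat_nat (n := n))//= ?leq_addr//; congr (_ + _).
  by apply: eq_big_nat => i /andP[_ ni]; rewrite ni ltnW.
rewrite -{1}[n]add0n big_addn addKn.
apply: eq_big_nat => i _.
rewrite [((i + n).+1 <= n)%N]leqNgt ltnS leq_addl /= -addSn !addnK.
case: leqP => // h; have -> : i = 0%N by lia.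
by rewrite add0n xn y0.
Qed.

End chain_infimum.

(** * Near-geodesics in snowflakes *)

Section snowflake_metric.
Context (R : realType) (s : R) (Y : metricType R).
Hypothesis s1 : 1 <= s.
Hypothesis Ls : Ls_metric s%:E Y.

Definition snow (x y : Y) : R := mdist x y `^ s.

Let s0 : 0 < s. Proof. exact: lt_le_trans s1. Qed.

Lemma snow_ge0 x y : 0 <= snow x y. Proof. exact: powR_ge0. Qed.
Lemma snowxx x : snow x x = 0.
Proof. by rewrite /snow mdistxx powR0 ?gt_eqF. Qed.
Lemma snow_sym x y : snow x y = snow y x.
Proof. by rewrite /snow metric_sym. Qed.
Lemma snow_triangle y x z : snow x z <= snow x y + snow y z.
Proof.
have /(powR_le2 (ltW s0) (mdist_ge0 _ _)) := Ls x z y.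
by rewrite powRVK// addr_ge0// powR_ge0.
Qed.

(** The exponent rises because the power of order [s t] of the new distance [d] is the chain infimum
    [tau], which satisfies the triangle inequality; [chain_bound] keeps [tau] comparable to [w]. *)
Lemma Ls_metric_improve (N : nat) : (1 < N)%N ->
  (forall B y z, reach snow B N y z -> snow y z <= (N%:R - 2^-1) * B) ->
  exists t : R, 1 < t /\ bilipschitz_to_Ls Y (s * t)%:E.
Proof.
move=> N1 contr; have [t [K [t1 K0 KK]]] := chain_exponent R N1.
have t0 : 0 < t by lra.
have K00 : 0 <= (N%:R : R) - 2^-1.
  have : (2 : R) <= N%:R by rewrite ler_nat.
  lra.
have bound x := @chain_bound _ _ snow snow_ge0 snowxx snow_triangle t x t0 N _ K
  N1 K00 K0 contr KK.
exists t; split => //.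
have st0 : 0 < s * t by rewrite mulr_gt0.
have st1 : (s * t)^-1 <= 1.
  by rewrite invf_le1// mulr_ege1// ltW.
pose w (x y : Y) := snow x y `^ t.
have w0 x y : 0 <= w x y by exact: powR_ge0.
have w_sym x y : w x y = w y x by rewrite /w snow_sym.
have wE x y : w x y `^ (s * t)^-1 = mdist x y.
  by rewrite /w /snow -(powRrM _ s t) powRK// mdist_ge0.
pose tau := chain_inf w.
have tau0 x y : 0 <= tau x y := chain_inf_ge0 w0 x y.
have tau_le x y : tau x y <= w x y := chain_inf_le w0 (chain_costs1 w x y).
have tau_ge x y : w x y <= K `^ t * tau x y.
  (* If [K = 0], then [snow] vanishes and no division by [K^t] takes place. *)
  have [K_0|K_neq0] := eqVneq K 0.
    move: (bound (fun i => if i is 0%N then x else y) 0%N 1%N isT) => /=.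
    rewrite K_0 mul0r /w => h.
    have -> : snow x y = 0 by apply/eqP; rewrite eq_le h snow_ge0.
    by rewrite powR0 ?gt_eqF// mulr_ge0 ?powR_ge0.
  have K_gt0 : 0 < K by rewrite lt_def K_neq0.
  rewrite mulrC -ler_pdivrMr ?powR_gt0//; apply: chain_inf_ge => n c <- <-.
  rewrite ler_pdivrMr ?powR_gt0// mulrC.
  have := powR_le2 (ltW t0) (snow_ge0 _ _) (bound c 0%N n isT).
  by rewrite powRM ?powR_ge0// powRVK// sumr_ge0// => i _; exact: w0.
pose d x y := tau x y `^ (s * t)^-1.
have d_le x y : d x y <= mdist x y.
  by rewrite -wE; apply: powR_le2 => //; rewrite invr_ge0 ltW.
pose C := (K `^ t) `^ (s * t)^-1.
have d_ge x y : mdist x y <= C * d x y.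
  rewrite -wE -powRM ?powR_ge0//; apply: powR_le2 => //.
  by rewrite invr_ge0 ltW.
have d0 x y : 0 <= d x y by exact: powR_ge0.
have dxx x : d x x = 0.
  by apply/eqP; rewrite eq_le d0 andbT -[leRHS](mdistxx x).
have dpos x y : d x y = 0 -> x = y.
  move=> e; apply: mdist_positivity; apply/eqP; rewrite eq_le mdist_ge0 andbT.
  by rewrite (le_trans (d_ge x y))// e mulr0.
have dsym x y : d x y = d y x.
  by rewrite /d /tau (chain_inf_sym w_sym).
have dtri y x z : d x z <= d x y + d y z.
  apply: le_trans (powR_subadditive _ _ _ _) => //; last by rewrite invr_gt0.
  by apply: powR_le2; rewrite ?invr_ge0 ?(ltW st0)//; exact: chain_inf_triangle.
have [Z [phi [bij phiE]]] := metric_of_dist dxx dpos dsym dtri.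
exists Z; split.
  (* Adding 1 secures a bi-Lipschitz constant of at least 1. *)
  exists (C + 1), phi; split => //; first by rewrite lerDr powR_ge0.
  have C0 : 0 <= C by exact: powR_ge0.
  move=> x y; rewrite phiE; apply/andP; split.
    rewrite ler_pdivrMr; last lra.
    by have := d_le (phi x) (phi y); have := d0 (phi x) (phi y); nra.
  by have := d_ge (phi x) (phi y); have := d0 (phi x) (phi y); nra.
move=> x y z; rewrite !phiE /d !powRVK//.
by apply: powR_le2; rewrite ?invr_ge0 ?(ltW st0)//; exact: chain_inf_triangle.
Qed.

End snowflake_metric.

Lemma bilipschitz_trans (R : realType) (X Y Z : metricType R) :
  bilipschitz_equivalent X Y -> bilipschitz_equivalent Y Z ->
  bilipschitz_equivalent X Z.
Proof.
move=> [L [f [L1 bf fL]]] [M [g [M1 bg gM]]].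
exists (L * M), (f \o g); split; [nra|exact: bij_comp|move=> x y /=].
have /andP[f1 f2] := fL (g x) (g y); have /andP[g1 g2] := gM x y.
apply/andP; split.
  apply: le_trans f1; rewrite invfM [L^-1 * _]mulrC mulrA ler_wpM2r//.
  by rewrite invr_ge0; lra.
by apply: (le_trans f2); rewrite -mulrA ler_wpM2l//; lra.
Qed.

Lemma snowflake_near_geodesics (R : realType) (X : metricType R) (s : R) :
  1 <= s -> snowflake X s%:E ->
  exists Y : metricType R, [/\ bilipschitz_equivalent X Y, Ls_metric s%:E Y &
    forall N : nat, (1 < N)%N -> exists (r : R) (x : nat -> Y),
      [/\ 0 < r, forall i, (i < N)%N -> snow s (x i) (x i.+1) <= r &
          (N%:R - 2^-1) * r <= snow s (x 0%N) (x N)]].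
Proof.
move=> s1 [[Y [XY LY]] sX]; exists Y; split => // N N1.
apply: contrapT => none.
(* A chain of [N] hops violating the bound would itself be a near-geodesic with [r = B]. *)
have [B y z hr|t [t1 [Z [YZ LZ]]]] := Ls_metric_improve s1 LY N1.
  rewrite leNgt; apply/negP => far.
  have [u [u0 uN ustep]] := reach_seq hr.
  have B0 : 0 <= B by apply: le_trans (ustep 0%N (ltnW N1)); exact: snow_ge0.
  apply: none; exists B, u; split => //; last by rewrite u0 uN ltW.
  (* [B = 0] would put [y] and [z] at distance 0, against [far]. *)
  rewrite lt_def B0 andbT; apply/eqP => B_0; move: far.
  have := rho_steps (snowxx s1) (snow_triangle s1 LY) (leq0n N)
    (fun i hi => ustep i hi).
  by rewrite u0 uN B_0 !mulr0 leNgt => /negP.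
suff : ((s * t)%:E <= s%:E)%E.
  rewrite lee_fin => h; nra.
rewrite sX; apply: ereal_sup_ubound; split; first
  by rewrite lee_fin mulr_ege1// ltW.
by exists Z; split => //; exact: bilipschitz_trans YZ.
Qed.

(** * Height on the discrete torus *)

Section second_moment.
Context (R : realDomainType) (U : finZmodType) (n : nat).

(* Translating [e] by [v] in the coordinate [j] alone does not change the factor
   indexed by [k], so the two halves of the sum coincide. *)
Lemma sum_increments_ortho (G : 'I_n -> U -> R) (v : 'rV[U]_n) (j k : 'I_n) :
  j != k ->
  \sum_(e : 'rV[U]_n) (G j ((e + v) 0 j) - G j (e 0 j)) *
    (G k ((e + v) 0 k) - G k (e 0 k)) = 0.
Proof.
move=> jk; under eq_bigr do rewrite mulrBl.
rewrite sumrB; apply/eqP; rewrite subr_eq0; apply/eqP.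
pose w : 'rV[U]_n := \row_i if i == j then v 0 j else 0.
rewrite [RHS](reindex_inj (addIr w)); apply: eq_bigr => e _.
by rewrite !mxE eqxx eq_sym (negbTE jk) addr0.
Qed.

(** When the square is expanded, orthogonality leaves only the [n] diagonal terms, each at most 1 at
    every point. *)
Lemma sum_increments_sqr (G : 'I_n -> U -> R) (v : 'rV[U]_n) :
  (forall j u, (G j (u + v 0 j) - G j u) ^+ 2 <= 1) ->
  \sum_(e : 'rV[U]_n) (\sum_j (G j ((e + v) 0 j) - G j (e 0 j))) ^+ 2 <=
  n%:R * #|{: 'rV[U]_n}|%:R.
Proof.
move=> G1; under eq_bigr => e _.
  rewrite expr2 big_distrl/=; under eq_bigr do rewrite big_distrr/=.
  over.
rewrite exchange_big/=.
have le1 (j : 'I_n) : \sum_(e : 'rV[U]_n)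
    \sum_i (G j ((e + v) 0 j) - G j (e 0 j)) * (G i ((e + v) 0 i) - G i (e 0 i))
    <= #|{: 'rV[U]_n}|%:R.
  rewrite exchange_big (bigD1 j)//= [X in _ + X]big1 ?addr0; last first.
    by move=> i ij; apply: sum_increments_ortho; rewrite eq_sym.
  rewrite -sumr_const; apply: ler_sum => e _.
  by rewrite -expr2 !mxE G1.
apply: le_trans (ler_sum _ (fun j _ => le1 j)) _.
by rewrite sumr_const card_ord mulr_natl.
Qed.

End second_moment.

(** The distance from [k] to 0 along the cycle of length [m]. *)
Definition zdist (m : nat) (k : 'Z_m) : nat := minn k (m - k).

Section zdist.
Context (m : nat) (m1 : (1 < m)%N).

Lemma val_Zp_addn (k : 'Z_m) (c : nat) : (c <= m)%N ->
  (k + c%:R : 'Z_m) = (if k + c < m then k + c else k + c - m)%N :> nat.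
Proof.
move=> cm; have km : (k < m)%N by rewrite -{2}(Zp_cast m1).
rewrite /= val_Zp_nat//; move: (k : nat) km => {}k km.
rewrite (Zp_cast m1) modnDmr.
case: ltnP => h; first by rewrite modn_small.
rewrite -{1}(subnK h) modnDr modn_small//; lia.
Qed.

Lemma zdist_le (k : 'Z_m) : (zdist k <= m)%N.
Proof. by rewrite /zdist geq_min; apply/orP; right; exact: leq_subr. Qed.

Lemma zdist_succ (k : 'Z_m) :
  (zdist (k + 1)%R <= (zdist k).+1)%N && (zdist k <= (zdist (k + 1)%R).+1)%N.
Proof.
have km : (k < m)%N by rewrite -{2}(Zp_cast m1).
have := val_Zp_addn k (ltnW m1); rewrite /zdist => ->.
by case: ltnP => h; lia.
Qed.

(** An absolute difference: at most one of the two truncated subtractions is nonzero. *)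
Definition antipodal_gap (k : 'Z_m) : nat :=
  (zdist k - zdist (k + m./2%:R)%R + (zdist (k + m./2%:R)%R - zdist k))%N.

(** The points 0 and [m / 2] are antipodal, so [k] lies on a shortest path between them;
    [zdist (k + m / 2)] is the distance from [k] to [m / 2]. *)
Lemma zdist_half_turn (k : 'Z_m) : ~~ odd m ->
  (zdist (k + m./2%:R)%R + zdist k = m./2)%N.
Proof.
move=> em; have km : (k < m)%N by rewrite -{2}(Zp_cast m1).
have hh : (m./2 + m./2 = m)%N by rewrite addnn even_halfK.
have h2 : (m./2 <= m)%N by rewrite -{2}hh leq_addr.
rewrite /zdist (val_Zp_addn k h2).
move: (k : nat) (m./2) hh km {h2} => {}k h; clear => <- km.
by case: ltnP => ?; lia.
Qed.

(* The gap is small only near [m / 4] and [3 m / 4], and a quarter turn moves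
   these points to places where it is about [m / 2]. *)
Lemma antipodal_gap_quarter (k : 'Z_m) : ~~ odd m ->
  (m <= 4 * (antipodal_gap k + antipodal_gap (k + (m %/ 4)%:R)%R))%N.
Proof.
move=> em; have km : (k < m)%N by rewrite -{2}(Zp_cast m1).
have q4 : (m %/ 4 <= m)%N by exact: leq_div.
(* The 1 is for [m] congruent to 2 modulo 4, where [m %/ 4] falls short of a quarter turn by one
   half. *)
have quarter : (m./2 <= 2 * (m %/ 4) + 1)%N by clear; lia.
have quarter' : (2 * (m %/ 4) <= m./2)%N by clear; lia.
have hh : (m./2 + m./2 = m)%N by rewrite addnn even_halfK.
(* By the half-turn identity the gap equals [|m / 2 - 2 zdist l|]. *)
have gap_lower (l : 'Z_m) :
    (m./2 <= antipodal_gap l + 2 * zdist l)%N /\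
    (2 * zdist l <= antipodal_gap l + m./2)%N.
  have := zdist_half_turn l em; rewrite /antipodal_gap.
  move: (zdist (l + _)) (zdist l) => c d; clear => <-; split; lia.
have [lo1 lo2] := gap_lower k.
have [lo3 lo4] := gap_lower (k + (m %/ 4)%:R).
move: lo1 lo2 lo3 lo4; move: (antipodal_gap k) (antipodal_gap (_ + _)) => c c'.
rewrite /zdist (val_Zp_addn k q4).
move: (k : nat) (m./2) (m %/ 4)%N hh km quarter quarter' {q4 gap_lower}.
clear => k h q <- km qh qh'.
by case: (leqP k h) => ?; case: ltnP => ?; lia.
Qed.

End zdist.

Definition torus_height (m n : nat) (e : 'rV['Z_m]_n) : nat :=
  \sum_(j < n) zdist (e 0%R j).

Section torus_height.
Context (m n : nat) (m1 : (1 < m)%N).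

Lemma torus_height_le (e : 'rV['Z_m]_n) : (torus_height e <= n * m)%N.
Proof.
rewrite -[n in (n * m)%N]card_ord -sum_nat_const.
by apply: leq_sum => j _; exact: zdist_le.
Qed.

Lemma torus_height_half (e : 'rV['Z_m]_n) (j : 'I_n) :
  let e' := e + delta_mx 0 j *+ m./2 in
  (torus_height e - torus_height e' + (torus_height e' - torus_height e))%N =
  antipodal_gap (e 0%R j).
Proof.
move=> e'; have split_j (f : 'I_n -> nat) :
  (\sum_i f i = f j + \sum_(i | i != j) f i)%N by exact: bigD1.
rewrite /torus_height /antipodal_gap !split_j.
have -> : (\sum_(i < n | i != j) zdist (e' 0%R i) =
  \sum_(i < n | i != j) zdist (e 0%R i))%N.
  apply: eq_bigr => i ij.
  by rewrite /e' !(mxE, mulmxnE) eqxx (negbTE ij) mul0rn addr0.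
by rewrite /e' !(mxE, mulmxnE) !eqxx !subnDr.
Qed.

Lemma torus_height_increment (R : realDomainType) (d : {ffun 'I_n -> 'I_3}) :
  \sum_(e : 'rV['Z_m]_n)
    ((torus_height (e + sign_vector m d))%:R - (torus_height e)%:R : R) ^+ 2
  <= n%:R * #|{: 'rV['Z_m]_n}|%:R.
Proof.
under eq_bigr do rewrite /torus_height !natr_sum -sumrB.
apply: (sum_increments_sqr (G := fun _ u => (zdist u)%:R)) => j u.
have sq (a b : nat) : (a <= b.+1)%N && (b <= a.+1)%N ->
    (a%:R - b%:R : R) ^+ 2 <= 1.
  case/andP; rewrite -2!(ler_nat R) -!natr1 => ab ba.
  by nra.
apply: sq; rewrite mxE.
(* The codes 0, 1, 2 stand for -1, 0, 1; a shift by -1 is a shift by 1 read backwards from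
   [u - 1]. *)
case: (d j) => [[|[|[|//]]]] i3 /=.
- by rewrite sub0r andbC; have := zdist_succ m1 (u - 1); rewrite subrK.
- by rewrite subrr addr0 !leqnSn.
- by rewrite [2%:R]mulr2n addrK; exact: zdist_succ.
Qed.

End torus_height.

(** * Averages of the height map over the torus *)

Lemma powR_le_add1 (R : realType) (v b : R) : 0 <= v -> 0 <= b -> b <= 1 ->
  v `^ b <= 1 + v.
Proof.
move=> v0 b0 b1; have [v1|v1] := leP v 1.
  have := powR_le2 b0 v0 v1; rewrite powR1; lra.
by have := ler1_powR (ltW v1) b1; lra.
Qed.

Section torus_averages.
Context (R : realType) (X Y : metricType R) (s p L r : R) (phi : Y -> X)
  (x : nat -> Y) (m n : nat).
Hypothesis s1 : 1 <= s.
Hypothesis LY : Ls_metric s%:E Y.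
Hypothesis p1 : 1 <= p.
Hypothesis L1 : 1 <= L.
Hypothesis phiL : forall u v : Y,
  mdist u v / L <= mdist (phi u) (phi v) <= L * mdist u v.
Hypothesis m1 : (1 < m)%N.
Hypothesis m_even : ~~ odd m.
Hypothesis r0 : 0 < r.
Hypothesis step : forall i, (i < n * m)%N -> snow s (x i) (x i.+1) <= r.
Hypothesis far : ((n * m)%:R - 2^-1) * r <= snow s (x 0%N) (x (n * m)%N).

Let a := p / s.
(** Heights are at most [n * m], so the chain is long enough to be indexed by them. *)
Let f (e : 'rV['Z_m]_n) : X := phi (x (torus_height e)).
Let snow_tri := @snow_triangle R s Y s1 LY.

Let s0 : 0 < s. Proof. exact: lt_le_trans s1. Qed.
Let p0 : 0 < p. Proof. exact: lt_le_trans p1. Qed.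
Let L0 : 0 < L. Proof. exact: lt_le_trans L1. Qed.
Let a0 : 0 < a. Proof. exact: divr_gt0. Qed.
Let card_gt0 : (0 : R) < #|{: 'rV['Z_m]_n}|%:R.
Proof. by rewrite ltr0n; apply/card_gt0P; exists 0. Qed.

Let mdist_snow (u v : Y) : mdist u v `^ p = snow s u v `^ a.
Proof. by rewrite /snow -powRrM /a mulrCA divff ?gt_eqF// mulr1. Qed.

Let gap (i j : nat) : nat := (i - j + (j - i))%N.

(** [(k - 1/2) r >= k r / 2] as soon as the gap [k] is at least 1. *)
Let snow_gap_ge i j : (i <= n * m)%N -> (j <= n * m)%N ->
  (gap i j)%:R * r / 2 <= snow s (x i) (x j).
Proof.
have lower := near_geodesic_lower (snowxx s1) snow_tri step far.
wlog ij : i j / (i <= j)%N.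
  move=> H; case: (leqP i j) => [|/ltnW] h hi hj; first exact: H.
  by rewrite snow_sym /gap addnC; exact: H.
move=> _ jN; have := lower i j; rewrite ij jN => /(_ isT).
rewrite /gap (eqP ij) add0n.
have [->|h] := eqVneq (j - i)%N 0%N; first
  by rewrite mul0r mul0r => _; exact: snow_ge0.
apply: le_trans.
have : (1 : R) <= (j - i)%:R by rewrite ler1n lt0n.
have := r0; nra.
Qed.

Let snow_gap_le i j : (i <= n * m)%N -> (j <= n * m)%N ->
  snow s (x i) (x j) <= (gap i j)%:R * r.
Proof.
wlog ij : i j / (i <= j)%N.
  move=> H; case: (leqP i j) => [|/ltnW] h hi hj; first exact: H.
  by rewrite snow_sym /gap addnC; exact: H.
move=> _ jN; rewrite /gap (eqP ij) add0n.
apply: (rho_steps (snowxx s1) snow_tri) => // k /andP[_ kj].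
by apply: step; exact: leq_trans kj jN.
Qed.

(** In each coordinate, a point and its quarter-turn translate cannot both have a gap below [m / 8].
    The better of the two gives a [snow] distance of at least [r m / 16]; pairing the translates
    costs the factor 1/2. *)
Lemma half_shift_average_ge :
  n%:R / 2 * ((r * m%:R / 16) `^ a / L `^ p) <=
  average (fun e => \sum_(j < n) mdist (f e) (half_shift f j e) `^ p).
Proof.
rewrite /average ler_pdivlMr// exchange_big/=.
have pt (e : 'rV['Z_m]_n) (j : 'I_n) :
    ((antipodal_gap (e 0 j))%:R * r / 2) `^ a / L `^ p <=
    mdist (f e) (half_shift f j e) `^ p.
  set e' := e + delta_mx 0 j *+ m./2.
  have /andP[lo _] := phiL (x (torus_height e)) (x (torus_height e')).
  apply: le_trans (powR_le2 (ltW p0) _ lo); last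
    by rewrite divr_ge0 ?mdist_ge0 ?ltW.
  rewrite [leRHS]powRM ?mdist_ge0 ?invr_ge0 ?(ltW L0)// mdist_snow.
  rewrite -(powR_inv1 (ltW L0)) -powRrM mulN1r powRN.
  rewrite ler_wpM2r ?invr_ge0 ?powR_ge0//.
  apply: powR_le2; rewrite ?(ltW a0)//.
    by rewrite !mulr_ge0 ?invr_ge0 ?ler0n// ltW.
  by rewrite -torus_height_half; apply: snow_gap_ge; exact: torus_height_le.
have half j : #|{: 'rV['Z_m]_n}|%:R * ((r * m%:R / 16) `^ a / L `^ p) / 2 <=
    \sum_(e : 'rV['Z_m]_n) mdist (f e) (half_shift f j e) `^ p.
  apply: le_trans (ler_sum _ (fun e _ => pt e j)).
  set G := fun k : 'Z_m => ((antipodal_gap k)%:R * r / 2) `^ a / L `^ p.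
  rewrite -/(\sum_(e : 'rV['Z_m]_n) G (e 0 j)).
  rewrite ler_pdivrMr// [leRHS]mulr_natr mulr2n.
  pose w : 'rV['Z_m]_n := delta_mx 0 j *+ (m %/ 4).
  rewrite [X in _ <= _ + X](reindex_inj (addIr w)) -big_split/=.
  rewrite mulr_natl -sumr_const; apply: ler_sum => e _.
  have -> : (e + w) 0 j = e 0 j + (m %/ 4)%:R.
    by rewrite !(mxE, mulmxnE) !eqxx.
  have := antipodal_gap_quarter m1 (e 0 j) m_even.
  move: (e 0 j) => k; set k' := k + _ => hq.
  rewrite /G -mulrDl ler_wpM2r ?invr_ge0 ?powR_ge0//.
  have big (c : nat) : (m <= 8 * c)%N ->
      (r * m%:R / 16) `^ a <= (c%:R * r / 2) `^ a.
    rewrite -(ler_nat R) natrM => mc; apply: powR_le2; rewrite ?(ltW a0)//.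
      by rewrite !mulr_ge0 ?invr_ge0 ?ler0n// ltW.
    by have := r0; nra.
  have two (c c' : nat) : (m <= 4 * (c + c') -> m <= 8 * c \/ m <= 8 * c')%N.
    by clear; lia.
  have [h|h] := two _ _ hq.
    by rewrite -[leLHS]addr0 lerD ?powR_ge0// big.
  by rewrite -[leLHS]add0r lerD ?powR_ge0// big.
apply: le_trans (ler_sum _ (fun j _ => half j)).
rewrite sumr_const card_ord -mulr_natl le_eqVlt; apply/orP; left; apply/eqP.
ring.
Qed.

Hypothesis p2 : p < 2.
Hypothesis n0 : (0 < n)%N.

Let a2 : a / 2 <= 1.
Proof.
rewrite ler_pdivrMr// mul1r /a ler_pdivrMr//.
have := p2; have := s1; lra.
Qed.

(** For fixed [delta], the squared height increment [D] averages to at most [n] over the torus, so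
    [1 + D / n] averages to at most 2. *)
Lemma delta_shift_average_le :
  average (fun e => average (fun delta : {ffun 'I_n -> 'I_3} =>
    mdist (f e) (delta_shift f delta e) `^ p)) <=
  2 * (L `^ p * (r `^ a * n%:R `^ (a / 2))).
Proof.
have nR : (0 : R) < n%:R by rewrite ltr0n.
set c := L `^ p * (r `^ a * n%:R `^ (a / 2)).
have c0 : 0 <= c by rewrite !mulr_ge0 ?powR_ge0.
have pt (e : 'rV['Z_m]_n) (d : {ffun 'I_n -> 'I_3}) :
    mdist (f e) (delta_shift f d e) `^ p <=
    c * (1 + ((torus_height (e + sign_vector m d))%:R -
      (torus_height e)%:R) ^+ 2 / n%:R).
  set e' := e + sign_vector m d.
  have /andP[_ up] := phiL (x (torus_height e)) (x (torus_height e')).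
  apply: le_trans (powR_le2 (ltW p0) (mdist_ge0 _ _) up) _.
  rewrite powRM ?mdist_ge0 ?(ltW L0)// mdist_snow -[leRHS]mulrA.
  rewrite ler_wpM2l ?powR_ge0//.
  have := snow_gap_le (torus_height_le e) (torus_height_le e').
  move/(powR_le2 (ltW a0) (snow_ge0 _ _ _))/le_trans; apply.
  rewrite mulrC powRM ?ler0n ?(ltW r0)// -[leRHS]mulrA ler_wpM2l ?powR_ge0//.
  set D := (_ - _) ^+ 2.
  have DE : D = (gap (torus_height e) (torus_height e'))%:R ^+ 2.
    rewrite /D /gap; move: (torus_height e) (torus_height e') => i j.
    have [ij|/ltnW ij] := leqP i j.
      by rewrite (eqP ij) add0n natrB.
    by rewrite (eqP ij) addn0 natrB// -sqrrN opprB.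
  have -> : (gap (torus_height e) (torus_height e'))%:R `^ a =
      (n%:R * (D / n%:R)) `^ (a / 2).
    rewrite mulrC divfK ?gt_eqF// DE -powR_mulrn// -powRrM; congr (_ `^ _).
    by rewrite mulrC divfK.
  have Dn : 0 <= D / n%:R by rewrite divr_ge0 ?sqr_ge0.
  rewrite powRM ?ler0n// ler_wpM2l ?powR_ge0//.
  (* This linear bound on the power [a / 2 <= 1] takes the place of Jensen's inequality. *)
  by apply: powR_le_add1 => //; rewrite divr_ge0// ltW.
have d_gt0 : (0 : R) < #|{ffun 'I_n -> 'I_3}|%:R.
  by rewrite ltr0n; apply/card_gt0P; exists [ffun=> ord0].
rewrite /average ler_pdivrMr// -mulr_suml ler_pdivrMr// exchange_big/=.
have inner (d : {ffun 'I_n -> 'I_3}) :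
    \sum_(e : 'rV['Z_m]_n) mdist (f e) (delta_shift f d e) `^ p <=
    2 * c * #|{: 'rV['Z_m]_n}|%:R.
  apply: le_trans (ler_sum _ (fun e _ => pt e d)) _.
  rewrite -mulr_sumr big_split/= sumr_const -mulr_suml.
  rewrite -[2 * c * _]mulrA mulrCA ler_wpM2l//.
  have := torus_height_increment m1 R d.
  rewrite mulrC -ler_pdivrMr//; lra.
apply: le_trans (ler_sum _ (fun d _ => inner d)) _.
by rewrite sumr_const -[leLHS]mulr_natr.
Qed.

End torus_averages.

(** * Comparison of growth rates in the cotype inequality *)

Theorem theorem1p5 (R : realType) (X : metricType R) (s p q : R)
    (hs : 1 <= s) (hX : snowflake X s%:E)
    (hp : 1 <= p) (hpq : p <= q) (hq : q < 2) :
  ~ exists m : nat -> nat, metric_cotype X p q m /\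
      (fun n : nat => (m n)%:R : R) =O_\oo (fun n : nat => n%:R `^ q^-1).
Proof.
have [Y [[L [phi [L1 _ phiL]]] LY geod]] := snowflake_near_geodesics hs hX.
case=> m [[scal [Gamma [G1 cotype]]] /eqO_exP[K K0 [n0 _ mK]]].
have p2 : p < 2 by lra.
have q0 : 0 < q by lra.
pose a := p / s.
have a0 : 0 < a by rewrite divr_gt0//; lra.
have ap : a <= p.
  by rewrite /a ler_pdivrMr ?ler_peMr//; lra.
(* Each of the two average bounds contributes a 2 and an [L^p]; [16^a] comes from the lower one. *)
pose C := 2 * 2 * L `^ p * L `^ p * 16 `^ a * Gamma `^ p * K `^ (p - a).
have main n : (0 < n)%N -> (n0 <= n)%N -> n%:R `^ (a / q - a / 2) <= C.
  move=> n_gt0 n0n.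
  have nR : (0 : R) < n%:R by rewrite ltr0n.
  have [m_gt0 m_even] := scal n n_gt0.
  have m1 : (1 < m n)%N by case: (m n) m_gt0 m_even => [|[|]].
  have mR : (0 : R) < (m n)%:R by rewrite ltr0n.
  have N1 : (1 < n * m n)%N by rewrite (leq_trans m1)// leq_pmull.
  have [r [x [r0 step far]]] := geod _ N1.
  have lo := half_shift_average_ge hs LY hp L1 phiL m1 m_even r0 step far.
  have up := delta_shift_average_le hs LY hp L1 phiL m1 r0 step p2 n_gt0.
  have {lo} := le_trans lo (cotype n n_gt0 _).
  set c := _ * n%:R `^ (1 - p / q).
  have c0 : 0 <= c by rewrite !mulr_ge0 ?powR_ge0.
  move=> /le_trans /(_ (ler_wpM2l c0 up)); rewrite /c -/a {c c0}.
  have {mK} mK : (m n)%:R <= K * n%:R `^ q^-1.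
    have := mK n n0n; rewrite !ger0_norm ?powR_ge0 ?ler0n//.
  (* Only [m^(p - a)] is estimated, with [p - a >= 0]; the factor [m^a] will cancel against the left
     side. *)
  have mpa : (m n)%:R `^ p <=
      (m n)%:R `^ a * (K `^ (p - a) * n%:R `^ ((p - a) / q)).
    have -> : (m n)%:R `^ p = (m n)%:R `^ a * (m n)%:R `^ (p - a).
      by rewrite -powRD ?(gt_eqF mR) ?implybT// addrC subrK.
    rewrite ler_wpM2l ?powR_ge0// [(p - a) / q]mulrC powRrM.
    rewrite -powRM ?powR_ge0 ?(ltW K0)//.
    by apply: powR_le2; rewrite ?subr_ge0 ?ler0n.
  set Lp := L `^ p; have Lp0 : 0 < Lp by rewrite powR_gt0//; lra.
  set Gp := Gamma `^ p; have Gp0 : 0 <= Gp by exact: powR_ge0.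
  rewrite powRM ?mulr_ge0 ?ler0n ?(ltW r0)// powRM ?ler0n ?(ltW r0)//.
  set ra := r `^ a; have ra0 : 0 < ra by exact: powR_gt0.
  set ma := (m n)%:R `^ a in mpa *; have ma0 : 0 < ma by exact: powR_gt0.
  set t16 := 16^-1 `^ a.
  have t16E : t16 * 16 `^ a = 1.
    by rewrite -powRM ?invr_ge0 ?ler0n// mulVf ?powR1// pnatr_eq0.
  set Kp := K `^ (p - a) in mpa *.
  set P := n%:R `^ (1 - p / q); set Q := n%:R `^ ((p - a) / q) in mpa *.
  set H := n%:R `^ (a / 2); set E := n%:R `^ (a / q - a / 2).
  (* The four exponents of [n] add up to 1. *)
  have nE : n%:R = E * (P * Q * H).
    have n_neq0 : (n%:R : R) != 0 by rewrite gt_eqF.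
    rewrite /E /P /Q /H -!powRD ?n_neq0 ?implybT// -[LHS]powRr1 ?ler0n//.
    by congr (_ `^ _); field; rewrite gt_eqF.
  have PQH : 0 < P * Q * H by rewrite !mulr_gt0// powR_gt0.
  have CE : C = 2 * 2 * Lp * Lp * Gp * Kp * 16 `^ a.
    by rewrite /C -/Lp -/Gp -/Kp -!mulrA (mulrC (16 `^ a)) !mulrA.
  have Kp0 : 0 <= Kp by exact: powR_ge0.
  have P0 : 0 <= P by exact: powR_ge0.
  have H0 : 0 <= H by exact: powR_ge0.
  clearbody Lp Gp Kp ra ma t16 P Q H E => ineq.
  (* Multiplying by [2 L^p] exposes a common factor, so that the scale [r] and [m^a] drop out. *)
  have {}ineq : E * t16 * (P * Q * H * ra * ma) <=
      2 * 2 * Lp * Lp * Gp * Kp * (P * Q * H * ra * ma).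
    have -> : E * t16 * (P * Q * H * ra * ma) =
        2 * Lp * (n%:R / 2 * (ra * ma * t16 / Lp)).
      rewrite [in RHS]nE; field.
      by rewrite gt_eqF.
    have -> : 2 * 2 * Lp * Lp * Gp * Kp * (P * Q * H * ra * ma) =
        2 * Lp * (Gp * (ma * (Kp * Q)) * P * (2 * (Lp * (ra * H)))) by ring.
    rewrite ler_wpM2l ?mulr_ge0 ?(ltW Lp0)//; apply: (le_trans ineq).
    rewrite ler_wpM2r ?mulr_ge0 ?powR_ge0 ?(ltW Lp0) ?(ltW ra0)//.
    by rewrite ler_wpM2r ?powR_ge0// ler_wpM2l.
  rewrite (ler_pM2r (mulr_gt0 (mulr_gt0 PQH ra0) ma0)) in ineq.
  have -> : E = E * t16 * 16 `^ a by rewrite -mulrA t16E mulr1.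
  by rewrite CE ler_wpM2r ?powR_ge0.
have e0 : 0 < a / q - a / 2.
  by rewrite -mulrBr mulr_gt0// subr_gt0 ltf_pV2 ?posrE.
(* At [B] the power with the positive exponent [a / q - a / 2] equals [C + 1], beyond the bound
   [C]. *)
pose B := (C + 1) `^ (a / q - a / 2)^-1.
have C0 : 0 <= C by rewrite /C !mulr_ge0 ?powR_ge0.
pose n := maxn n0.+1 (Num.truncn B).+1.
have nB : B <= n%:R.
  apply: (@le_trans _ _ (Num.truncn B).+1%:R); last by rewrite ler_nat leq_maxr.
  by apply: ltW; rewrite truncnS_gt.
have n1 : (n0 < n)%N by rewrite leq_maxl.
have := main n (leq_ltn_trans (leq0n _) n1) (ltnW n1).
have /le_trans h := powR_le2 (ltW e0) (powR_ge0 _ _) nB.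
move=> /h; rewrite /B powRVK//; last lra.
lra.
Qed.
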